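(* Let $k$ be an even positive integer, let $G$ be a graph in which every vertex has even degree, and let $f:V(G)\to\mathbb{Z}_2$ be a mapping with $\sum_{v\in V(G)} f(v)\equiv 0\pmod 2$. If $d_G(X)\ge 3k-2$ for every vertex set $X$ with $\sum_{v\in X} f(v)$ odd, or if $G$ is $(2k-2)$-tree-connected, then $G$ can be edge-decomposed into $f$-parity factors $G_1,\ldots,G_k$ such that for each $i$ and each vertex $v$, $$|d_{G_i}(v)-d_G(v)/k|<2.$$
   Context: Graphs are finite and may have loops and multiple edges; a loop contributes $2$ to the degree $d_G(v)$. For a vertex set $X$, $d_G(X)$ denotes the number of edges with exactly one end in $X$. A graph is $m$-tree-connected if it contains $m$ edge-disjoint spanning trees. An $f$-parity factor is a spanning subgraph $F$ such that $d_F(v)\equiv f(v)\pmod 2$ for every vertex $v$. ''Edge-decomposed into factors'' means the edge set is partitioned into the edge sets of spanning subgraphs. *)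

(* Defs.v *)
From HB Require Import structures.
From mathcomp Require Import all_boot all_order all_algebra.

Set Implicit Arguments.
Unset Strict Implicit.
Unset Printing Implicit Defensive.

(* Finite undirected multigraphs, loops and parallel edges allowed.  The two
   ends of an edge are stored as an ordered pair; every notion below is
   invariant under swapping its components. *)
Record mgraph := MGraph {
  vertex : finType;
  edge : finType;
  ends : edge -> vertex * vertex
}.

(* A spanning subgraph of G is represented by its edge set {set edge G}; G
   itself, as a spanning subgraph, is [set: edge G]. *)

Definition joins (G : mgraph) (e : edge G) (x y : vertex G) : bool :=
  (ends e == (x, y)) || (ends e == (y, x)).

(* A loop at v satisfies both tests, hence contributes 2. *)
Definition deg (G : mgraph) (A : {set edge G}) (v : vertex G) : nat :=
  \sum_(e in A) (((ends e).1 == v) + ((ends e).2 == v)).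

Definition cut_deg (G : mgraph) (X : {set vertex G}) : nat :=
  #|[set e : edge G | ((ends e).1 \in X) (+) ((ends e).2 \in X)]|.

Definition sub_adj (G : mgraph) (A : {set edge G}) : rel (vertex G) :=
  fun x y => [exists e in A, joins e x y].

Definition sub_connected (G : mgraph) (A : {set edge G}) : Prop :=
  forall x y : vertex G, connect (sub_adj A) x y.

(* A cycle v_0 e_0 v_1 e_1 ... v_(n-1) e_(n-1) v_0 with n >= 1 is the sequence
   of the pairs (v_i, e_i); a loop is a cycle with n = 1, and two parallel
   edges form a cycle with n = 2. *)
Definition is_cycle (G : mgraph) (A : {set edge G})
    (c : seq (vertex G * edge G)) : bool :=
  [&& c != [::], uniq (unzip1 c), uniq (unzip2 c),
      all (fun e => e \in A) (unzip2 c)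
    & cycle (fun a b => joins a.2 a.1 b.1) c].

Definition acyclic (G : mgraph) (A : {set edge G}) : Prop :=
  forall c, ~~ is_cycle A c.

Definition spanning_tree (G : mgraph) (A : {set edge G}) : Prop :=
  sub_connected A /\ acyclic A.

Definition tree_connected (m : nat) (G : mgraph) : Prop :=
  exists T : 'I_m -> {set edge G},
    (forall i, spanning_tree (T i)) /\
    (forall i j, i != j -> [disjoint T i & T j]).

Definition parity_factor (G : mgraph) (f : vertex G -> 'Z_2)
    (A : {set edge G}) : Prop :=
  forall v, ((deg A v)%:R = f v)%R.

(* The parts are indexed and may be empty, as factors may have no edges. *)
Definition edge_decomposition (G : mgraph) (k : nat)
    (F : 'I_k -> {set edge G}) : Prop :=
  \bigcup_(i < k) F i = [set: edge G] /\
  (forall i j, i != j -> [disjoint F i & F j]).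

(* Main.v *)
Require Import Defs.
From HB Require Import structures.
From mathcomp Require Import all_boot all_order all_algebra.
From mathcomp Require Import zify ring lra.
Import Order.TTheory GRing.Theory Num.Theory.

(* Write an edge decomposition as a colouring of the edges by k colours.

   Equitability is a matter of two colours at a time.  If H is the union of two
   disjoint f-parity factors then H is even and each of its components contains
   an even number of vertices with f = 1, so H has an orientation with
   out(v) = d_H(v)/2 + f(v) mod 2.  Pairing out-edges with out-edges and in-edges
   with in-edges at each vertex, H splits again into two f-parity factors whose
   degrees differ by at most 2 everywhere.  Hence a decomposition into f-parity
   factors which minimises the sum of the squares of all degrees satisfies
   |d_i(v) - d_j(v)| <= 2 for all i, j and v, which gives the bound.

   For existence, since k is even and G Eulerian it is enough to find k disjoint
   f-parity factors: the other edges can be added to any one of them.  With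
   2k - 2 >= k disjoint spanning trees each tree contains one.  In the other case
   only d_G(X) >= 2k for f-odd X is used.  Vertices with f = 0 are removed by
   splitting off pairs of edges, which preserves this condition.  When f = 1 on
   all non-isolated vertices, there are at least k|W| edges on the set W of these
   vertices, too many for k forests, so by matroid union some set of at least two
   vertices carries k disjoint connected spanning subgraphs; this set is
   contracted. *)

Section Multigraph.

Set Implicit Arguments.
Unset Strict Implicit.
Unset Printing Implicit Defensive.

Variables (V E : finType) (en : E -> V * V).
Implicit Types (A B J H S : {set E}) (x y v : V) (e p : E).

Definition edeg A v : nat := \sum_(e in A) (((en e).1 == v) + ((en e).2 == v)).

Definition ecut (X : {set V}) : nat :=
  #|[set e | ((en e).1 \in X) (+) ((en e).2 \in X)]|.

Definition adj A : rel V :=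
  fun x y => [exists e in A, (en e == (x, y)) || (en e == (y, x))].

Definition conn A x y := connect (adj A) x y.

Lemma oddsum (I : finType) (P : pred I) (F : I -> nat) :
  odd (\sum_(i | P i) F i) = \big[addb/false]_(i | P i) odd (F i).
Proof. exact: (big_morph odd oddD). Qed.

Lemma odd_edeg A v :
  odd (edeg A v) =
  \big[addb/false]_e ((e \in A) && (((en e).1 == v) (+) ((en e).2 == v))).
Proof.
rewrite oddsum big_mkcond /=; apply: eq_bigr => e _.
by case: (e \in A) => //=; rewrite oddD !oddb.
Qed.

Definition symdiff A B := [set e | (e \in A) (+) (e \in B)].

Lemma odd_edeg_symdiff A B v :
  odd (edeg (symdiff A B) v) = odd (edeg A v) (+) odd (edeg B v).
Proof.
rewrite !odd_edeg -big_split /=; apply: eq_bigr => e _.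
by rewrite inE andb_addl.
Qed.

Lemma edeg_disjointU A B v :
  [disjoint A & B] -> edeg (A :|: B) v = edeg A v + edeg B v.
Proof. by move=> dAB; rewrite /edeg -bigU //; apply: eq_bigl => e; rewrite inE. Qed.

Lemma adj_sym A : symmetric (adj A).
Proof. by move=> x y; apply: eq_existsb => e; rewrite orbC. Qed.

Lemma conn_refl A x : conn A x x.
Proof. exact: connect0. Qed.

Lemma conn_sym A x y : conn A x y = conn A y x.
Proof. exact: (sym_connect_sym (@adj_sym A)). Qed.

Lemma conn_trans A y x z : conn A x y -> conn A y z -> conn A x z.
Proof. exact: connect_trans. Qed.

Lemma conn_edge A e : e \in A -> conn A (en e).1 (en e).2.
Proof.
move=> eA; apply/connect1/exists_inP; exists e => //.
by case: (en e) => a b; rewrite eqxx.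
Qed.

Lemma conn_sub A B :
  {in A, forall e, conn B (en e).1 (en e).2} ->
  forall x y, conn A x y -> conn B x y.
Proof.
move=> AB x y; apply: connect_sub => {}x {}y /exists_inP[e eA].
case/orP=> /eqP ee; have := AB e eA; rewrite ee //=.
by rewrite conn_sym.
Qed.

Lemma conn_mono A B x y : A \subset B -> conn A x y -> conn B x y.
Proof. by move/subsetP=> AB; apply: conn_sub => e /AB; apply: conn_edge. Qed.

Lemma conn_closed A (U : {set V}) x y :
  {in A, forall e, ((en e).1 \in U) = ((en e).2 \in U)} ->
  conn A x y -> (x \in U) = (y \in U).
Proof.
move=> cl /connectP[p]; elim: p x => [|z p IH] x /= => [_ ->|] //.
case/andP=> /exists_inP[e eA xz] pz ey; rewrite -(IH z) //.
by case/orP: xz => /eqP ee; have := cl e eA; rewrite ee.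
Qed.

Lemma path_join A x y :
  conn A x y ->
  exists2 J : {set E}, J \subset A
    & forall v, odd (edeg J v) = (x == v) (+) (y == v).
Proof.
case/connectP=> p; elim: p x => [|z p IH] x /=.
  move=> _ ->; exists set0; rewrite ?sub0set // => v.
  by rewrite /edeg big_set0 addbb.
case/andP=> /exists_inP[e eA xz] pz ey.
have [J JA Jv] := IH z pz ey.
exists (symdiff [set e] J) => [|v].
  apply/subsetP=> e'; rewrite !inE; have [-> //|/=] := eqVneq e' e.
  by move=> _ /(subsetP JA).
rewrite odd_edeg_symdiff Jv /edeg big_set1 oddD !oddb.
by case/orP: xz => /eqP -> /=; case: (x == v) (z == v) (y == v) => [] [] [].
Qed.

Lemma join_exists A (g : V -> bool) :
  (forall x, ~~ odd (\sum_(v | conn A x v) g v)) ->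
  exists2 J : {set E}, J \subset A & forall v, odd (edeg J v) = g v.
Proof.
have [n] := ubnP (\sum_v g v); elim: n g => // n IH g; rewrite ltnS => le_n ev.
have [[x gx]|no_g] := altP (@existsP _ g); last first.
  exists set0; rewrite ?sub0set // => v; rewrite /edeg big_set0.
  by rewrite (negbTE (existsPn no_g v)).
have [y /andP[xy yx] gy] : exists2 y, conn A x y && (y != x) & g y.
  apply/exists_inP; apply: contraR (ev x) => /exists_inPn no_y.
  rewrite (bigD1 x) ?conn_refl //= big1 => [|v xv]; first by rewrite gx.
  by rewrite (negbTE (no_y v xv)).
pose g' v := g v (+) (x == v) (+) (y == v).
have g'x : g' x = false by rewrite /g' gx eqxx (negbTE yx).
have g'y : g' y = false by rewrite /g' gy eqxx eq_sym (negbTE yx).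
have [||J JA Jv] := IH g'.
- apply: leq_trans le_n; rewrite [X in _ < X](bigD1 x) //= gx add1n ltnS.
  rewrite (bigD1 x) //= g'x add0n; apply: leq_sum => v vx.
  rewrite /g' [x == v]eq_sym (negbTE vx) addbF.
  by have [<-|] := eqVneq y v; rewrite ?gy ?addbF.
- move=> z; have -> : odd (\sum_(v | conn A z v) g' v)
      = odd (\sum_(v | conn A z v) g v).
    rewrite !oddsum; under eq_bigr do rewrite oddb.
    under [RHS]eq_bigr do rewrite oddb.
    rewrite !big_split /= -addbA -[RHS]addbF; congr (_ (+) _).
    have delta w : \big[addb/false]_(v | conn A z v) (w == v) = conn A z w.
      rewrite big_mkcond (bigD1 w) //= eqxx big1 ?addbF; first by case: ifP.
      by move=> v; rewrite eq_sym => /negbTE ->; rewrite if_same.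
    have /(same_connect_r (sym_connect_sym (@adj_sym A))) zxy := xy.
    by rewrite !delta /conn zxy addbb.
  exact: ev.
have [K KA Kv] := path_join xy.
exists (symdiff J K) => [|v].
  apply/subsetP=> e; rewrite inE.
  by case: (boolP (e \in J)) => [/(subsetP JA)|_ /= /(subsetP KA)].
by rewrite odd_edeg_symdiff Jv Kv /g' -!addbA [(y == v) (+) _]addbC -addbA addbb
  addbF addbb addbF.
Qed.

End Multigraph.

Section Pairing.

Set Implicit Arguments.
Unset Strict Implicit.
Unset Printing Implicit Defensive.

Definition pairing_on (D : finType) (S : {set D}) (a : D -> D) :=
  [/\ involutive a, {in S, forall x, a x \in S} & {in S, forall x, a x != x}].

Lemma even_fibres_pairing (D : finType) (T : eqType) (S : {set D}) (t : D -> T) :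
  (forall v, ~~ odd #|[set y in S | t y == v]|) ->
  exists2 a, pairing_on S a & forall x, t (a x) = t x.
Proof.
move=> ev; pose l v := enum [set y in S | t y == v].
pose i x := index x (l (t x)).
pose j n := if odd n then n.-1 else n.+1.
pose a x := if x \in S then nth x (l (t x)) (j (i x)) else x.
have jK : involutive j.
  by case=> // n; rewrite /j /=; case o: (odd n); rewrite /= o.
have jN n : j n != n by rewrite /j; case: n => //= n; case: ifP => _; lia.
have lP x v : (x \in l v) = (x \in S) && (t x == v) by rewrite mem_enum inE.
have i_lt x : x \in S -> i x < size (l (t x)) by move=> xS; rewrite index_mem lP xS /=.
have j_lt x : x \in S -> j (i x) < size (l (t x)).
  move=> /i_lt; have := ev (t x); rewrite cardE -/(l _) /j.
  by case: ifP; lia.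
have aE x : x \in S -> a x \in l (t x).
  by move=> xS; rewrite /a xS mem_nth ?j_lt.
have aS x : x \in S -> a x \in S by move=> /aE; rewrite lP => /andP[].
have ta x : t (a x) = t x.
  have [xS|xS] := boolP (x \in S); last by rewrite /a (negbTE xS).
  by have := aE x xS; rewrite lP => /andP[_ /eqP].
have ia x : x \in S -> i (a x) = j (i x).
  by move=> xS; rewrite /i ta {1}/a xS index_uniq ?enum_uniq ?j_lt.
exists a => //; split=> // x.
- have [xS|xS] := boolP (x \in S); last by rewrite /a !(negbTE xS).
  rewrite {1}/a aS // ta ia //.
  rewrite jK.
  by rewrite (set_nth_default x) ?i_lt // nth_index // lP xS /=.
- move=> xS; apply/eqP => ax; have := ia x xS; rewrite ax.
  by move/eqP; rewrite eq_sym (negbTE (jN _)).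
Qed.

(* The composite of the two pairings moves every point along an alternating
   cycle, and two paired points never lie in the same orbit of it. *)
Lemma two_pairings_colouring (D : finType) (S : {set D}) (a b : D -> D) :
  pairing_on S a -> pairing_on S b ->
  exists c : D -> bool,
    {in S, forall x, c (a x) = ~~ c x} /\ {in S, forall x, c (b x) = ~~ c x}.
Proof.
case=> aK aS aN [bK bS bN]; pose s x := a (b x).
have s_inj : injective s by move=> x y /(inv_inj aK) /(inv_inj bK).
have sym_s : connect_sym (frel s) by exact: fconnect_sym.
have sa x n : x \in S -> iter n s x != a x.
  have [m] := ubnP n; elim: m n x => // m IH [|[|n]] x lt_nm xS.
  - by rewrite eq_sym aN.
  - by rewrite /= /s (inj_eq (inv_inj aK)) bN.
  have sxS : s x \in S by rewrite aS ?bS.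
  rewrite iterS iterSr; apply/eqP=> /(inv_inj aK) eq_x.
  have /eqP[] := IH n (s x) (ltac:(lia)) sxS.
  by rewrite /s aK -[in RHS]eq_x bK.
pose r x := enum_rank (froot s x).
have rb x : r (b x) = r (a x).
  rewrite /r; congr (enum_rank _); apply/eqP; rewrite root_connect //.
  by rewrite -{2}[x]bK; exact: fconnect1.
have rN x : x \in S -> r (a x) != r x :> nat.
  move=> xS; rewrite val_eqE (inj_eq enum_rank_inj) root_connect // sym_s.
  by apply/negP=> /iter_findex ex; have := sa x (findex s x (a x)) xS; rewrite ex eqxx.
pose c x := r x < r (a x); exists c; split=> x xS; rewrite /c.
  by rewrite aK; case: ltngtP (rN x xS).
by have := rN x xS; rewrite -(rb (b x)) bK rb; case: ltngtP.
Qed.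

End Pairing.

Section Balancing.

Set Implicit Arguments.
Unset Strict Implicit.
Unset Printing Implicit Defensive.

Lemma sum_eqb (T : finType) (U : {set T}) (x : T) :
  \sum_(v in U) (x == v) = (x \in U).
Proof.
rewrite big_mkcond (bigD1 x) //= eqxx big1 ?addn0; first by case: ifP.
by move=> v; rewrite eq_sym => /negbTE ->; rewrite if_same.
Qed.

Lemma card_sumb (T : finType) (P : pred T) : #|[set x | P x]| = \sum_x P x.
Proof. by rewrite -sum1_card big_mkcond; apply: eq_bigr => x _; rewrite inE; case: (P x). Qed.

Lemma pairing_half (D : finType) (T : eqType) (S : {set D}) (t : D -> T)
    (a : D -> D) (c : D -> bool) (v : T) :
  pairing_on S a -> (forall x, t (a x) = t x) ->
  {in S, forall x, c (a x) = ~~ c x} ->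
  #|[set y in S | t y == v]| = #|[set y in S | (t y == v) && c y]|.*2.
Proof.
move=> [aK aS _] ta ca; rewrite -(cardsID [set y | c y]) -addnn.
congr (_ + _).
  by apply: eq_card => y; rewrite !inE andbA.
rewrite -(card_imset _ (inv_inj aK)); apply: eq_card => y.
have -> : (y \in a @: ([set y0 in S | t y0 == v] :\: [set y0 | c y0]))
    = (a y \in [set y0 in S | t y0 == v] :\: [set y0 | c y0]).
  by rewrite -{1}[y]aK mem_imset //; exact: inv_inj.
rewrite !inE ta; have [yS|yS] := boolP (y \in S).
  by rewrite aS // ca // negbK andbC.
suff /negbTE-> : a y \notin S by rewrite !andbF.
by apply: contra yS => /aS; rewrite aK.
Qed.

Section Degrees.

Variables (V E : finType) (en : E -> V * V).
Implicit Types (A B J H : {set E}) (U X : {set V}) (v : V).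

Lemma sum_edeg A U :
  \sum_(v in U) edeg en A v =
  \sum_(e in A) (((en e).1 \in U) + ((en e).2 \in U)).
Proof.
rewrite exchange_big /=; apply: eq_bigr => e _.
by rewrite big_split /= !sum_eqb.
Qed.

Lemma sum_edeg_closed A U :
  {in A, forall e, ((en e).1 \in U) = ((en e).2 \in U)} ->
  \sum_(v in U) edeg en A v = (\sum_(e in A) ((en e).1 \in U)).*2.
Proof.
move=> cl; rewrite sum_edeg -addnn -big_split /=.
by apply: eq_bigr => e eA; rewrite -cl.
Qed.

Lemma comp_closed A x :
  {in A, forall e, ((en e).1 \in [set v | conn en A x v])
                 = ((en e).2 \in [set v | conn en A x v])}.
Proof.
move=> e eA; rewrite !inE.
have /(same_connect_r (sym_connect_sym (@adj_sym _ _ en A))) xe := conn_edge en eA.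
exact: xe.
Qed.

(* After reversing the edges of J the out-degrees have the required parity.  A
   vertex of odd out-degree gets a dummy element paired once with an out-edge and
   once with an in-edge, so that these two edges receive the same colour. *)
Lemma balanced_split A B :
  [disjoint A & B] -> (forall v, odd (edeg en A v) = odd (edeg en B v)) ->
  exists A' : {set E},
    [/\ A' \subset A :|: B,
        forall v, odd (edeg en A' v) = odd (edeg en A v)
      & forall v, edeg en A' v <= edeg en ((A :|: B) :\: A') v + 2
               /\ edeg en ((A :|: B) :\: A') v <= edeg en A' v + 2].
Proof.
move=> dAB oAB; pose H := A :|: B; rewrite -/H.
have dH v : edeg en H v = edeg en A v + edeg en B v by exact: edeg_disjointU.
have evH v : (edeg en H v)./2.*2 = edeg en H v.
  by rewrite even_halfK // dH oddD oAB addbb.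
pose o v := \sum_(e in H) ((en e).1 == v).
pose g v := odd (o v) (+) odd (edeg en H v)./2 (+) odd (edeg en A v).
have [|J JH Jg] := @join_exists _ _ en H g.
  move=> x; pose U := [set v | conn en H x v].
  have cl := @comp_closed H x; rewrite -/U in cl.
  under eq_bigl do rewrite -[conn en H x _]inE -/U.
  pose m := \sum_(e in H) ((en e).1 \in U).
  have so : \sum_(v in U) o v = m.
    by rewrite /o exchange_big; apply: eq_bigr => e _; rewrite sum_eqb.
  have sh : \sum_(v in U) (edeg en H v)./2 = m.
    apply: double_inj; rewrite -sum_edeg_closed // -mul2n big_distrr /=.
    by apply: eq_bigr => v _; rewrite mul2n evH.
  have sA : ~~ odd (\sum_(v in U) edeg en A v).
    rewrite sum_edeg_closed ?odd_double // => e eA.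
    by apply: cl; rewrite inE eA.
  rewrite oddsum; under eq_bigr do rewrite oddb.
  rewrite !big_split /= -!oddsum; move: sA so sh.
  by rewrite oddsum => /negbTE -> -> ->; rewrite addbb.
pose tl e := if e \in J then (en e).2 else (en e).1.
pose hd e := if e \in J then (en e).1 else (en e).2.
have degE K v : edeg en K v
    = \sum_(e in K) (tl e == v) + \sum_(e in K) (hd e == v).
  rewrite -big_split /=; apply: eq_bigr => e _.
  by rewrite /tl /hd; case: (e \in J); rewrite // addnC.
pose out v := \sum_(e in H) (tl e == v); pose inn v := \sum_(e in H) (hd e == v).
have odd_out v : odd (out v) = odd (edeg en H v)./2 (+) odd (edeg en A v).
  have -> : odd (out v) = odd (o v) (+) odd (edeg en J v).
    rewrite odd_edeg /out /o !oddsum !(big_mkcond (fun e => e \in H)) /=.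
    rewrite -big_split /=; apply: eq_bigr => e _; rewrite /tl !oddb.
    have [eJ|_] /= := boolP (e \in J); last by rewrite addbF.
    by rewrite (subsetP JH e eJ); do 2!case: (_ == v).
  by rewrite Jg /g; do 3!case: (odd _).
have odd_inn v : odd (inn v) = odd (out v).
  have := congr1 odd (degE H v); rewrite oddD -evH odd_double.
  by rewrite -/(out v) -/(inn v); do 2!case: (odd _).
pose S := [set z : E + V | match z with inl e => e \in H | inr v => odd (out v) end].
pose ft (t : E -> V) (z : E + V) := match z with inl e => t e | inr v => v end.
have cardS (t : E -> V) (c : E + V -> bool) v :
    #|[set y in S | (ft t y == v) && c y]|
    = \sum_(e in [set e in H | c (inl e)]) (t e == v) + (odd (out v) && c (inr v)).
  rewrite card_sumb big_sumType /=; congr (_ + _).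
    rewrite [RHS]big_mkcond; apply: eq_bigr => e _; rewrite !inE /=.
    by case: (_ || _); case: (c _); case: (t e == v).
  rewrite (bigD1 v) //= inE eqxx big1 ?addn0 // => w /negbTE ->.
  by rewrite andbF.
have cardS1 (t : E -> V) v :
    #|[set y in S | ft t y == v]| = \sum_(e in H) (t e == v) + odd (out v).
  have -> : [set y in S | ft t y == v] = [set y in S | (ft t y == v) && xpredT y].
    by apply/setP=> y; rewrite !inE andbT.
  by rewrite cardS andbT; congr (_ + _); apply: eq_bigl => e; rewrite !inE andbT.
have pair (t : E -> V) : (forall v, odd (\sum_(e in H) (t e == v)) = odd (out v)) ->
    exists2 a, pairing_on S a & forall z, ft t (a z) = ft t z.
  by move=> ot; apply: even_fibres_pairing => v; rewrite cardS1 oddD ot oddb addbb.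
have [|a aP ta] := pair tl; first by [].
have [|b bP tb] := pair hd; first exact: odd_inn.
have [c [ca cb]] := two_pairings_colouring aP bP.
pose A' := [set e in H | c (inl e)].
have eq_out v := pairing_half v aP ta ca; have eq_inn v := pairing_half v bP tb cb.
have degA' v : edeg en A' v + (odd (out v) && c (inr v)).*2
    = (edeg en H v)./2 + odd (out v).
  have := eq_out v; have := eq_inn v; rewrite !cardS !cardS1.
  have := degE H v; have := degE A' v; have := evH v.
  by rewrite -/A'; lia.
have A'H : A' \subset H by apply/subsetP=> e; rewrite inE => /andP[].
have degD v : edeg en A' v + edeg en (H :\: A') v = edeg en H v.
  by rewrite /edeg [RHS](big_setID A') /= (setIidPr A'H).
exists A'; split=> // v; last first.
  have := degA' v; have := degD v; have := evH v.
  by case: (odd _); case: (c _); rewrite /=; lia.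
have := congr1 odd (degA' v); rewrite !oddD odd_double addbF oddb odd_out => ->.
by do 2!case: (odd _).
Qed.

End Degrees.
End Balancing.

Section Colourings.

Set Implicit Arguments.
Unset Strict Implicit.
Unset Printing Implicit Defensive.

Lemma sum_sqr_gap a b :
  exists2 d, a ^ 2 + b ^ 2 + a ^ 2 + b ^ 2 = (a + b) ^ 2 + d ^ 2
    & a = b + d \/ b = a + d.
Proof.
have [le_ab|/ltnW le_ba] := leqP a b.
  have := subnKC le_ab; set d := b - a => <-; exists d; last by right.
  by rewrite -!mulnn; ring.
have := subnKC le_ba; set d := a - b => <-; exists d; last by left.
by rewrite -!mulnn; ring.
Qed.

Lemma sqr_balance a b a' b' :
  a' + b' = a + b -> odd a' = odd a -> odd b = odd a ->
  a' <= b' + 2 -> b' <= a' + 2 ->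
  a' ^ 2 + b' ^ 2 <= a ^ 2 + b ^ 2
  /\ (b + 2 < a -> a' ^ 2 + b' ^ 2 < a ^ 2 + b ^ 2).
Proof.
move=> eab oa ob ab' ba'.
have [d Ed hd] := sum_sqr_gap a b; have [d' Ed' hd'] := sum_sqr_gap a' b'.
have ledd : d' <= d.
  have ob' : odd b' = odd a'.
    by have := congr1 odd eab; rewrite !oddD oa ob; case: (odd a); case: (odd b').
  by clear Ed Ed'; lia.
rewrite {}eab in Ed'; split.
  have := leq_sqr d' d; rewrite ledd; move: Ed Ed'; clear.
  by move: (d ^ 2) (d' ^ 2) => u u'; lia.
move=> lt_ba; have := ltn_sqr d' d.
have -> : d' < d by move: hd hd' ab' ba' lt_ba; clear; lia.
move: Ed Ed'; clear; move: (d ^ 2) (d' ^ 2) => u u'; lia.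
Qed.

Section Balanced.

Variables (V E : finType) (en : E -> V * V) (k : nat) (f : V -> bool).
Implicit Types (c : {ffun E -> 'I_k}).

Definition cls c i := [set e | c e == i].

Definition parity_colouring c := forall i v, odd (edeg en (cls c i) v) = f v.

Lemma balanced_colouring c0 :
  parity_colouring c0 ->
  exists2 c, parity_colouring c &
    forall i j v, edeg en (cls c i) v <= edeg en (cls c j) v + 2.
Proof.
move=> P0; pose P c := [forall i, forall v, odd (edeg en (cls c i) v) == f v].
have PP (c : {ffun E -> 'I_k}) : reflect (parity_colouring c) (P c).
  apply: (iffP forallP) => [Pc i v|Pc i]; first exact/eqP/(forallP (Pc i)).
  by apply/forallP=> v; rewrite Pc.
pose M c := \sum_i \sum_v edeg en (cls c i) v ^ 2.
case: (@arg_minnP _ c0 P M (introT (PP c0) P0)) => c /PP Pc c_min.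
exists c => // i j v; rewrite leqNgt; apply/negP=> lt_ji.
have ij : i != j by apply: contraTneq lt_ji => ->; rewrite -leqNgt leq_addr.
have dij : [disjoint cls c i & cls c j].
  apply/pred0P=> e /=; rewrite !inE.
  by case: eqP => // ->; rewrite (negbTE ij).
have [|A [AH oA bA]] := @balanced_split _ _ en _ _ dij; first by move=> w; rewrite !Pc.
pose c' := [ffun e => if e \in cls c i :|: cls c j then if e \in A then i else j
                      else c e].
have c'i : cls c' i = A.
  apply/setP=> e; rewrite inE ffunE; case: (boolP (e \in _ :|: _)) => eH.
    by case: ifP; rewrite ?eqxx // eq_sym (negbTE ij).
  have /negbTE-> : e \notin A by apply: contra eH; apply: (subsetP AH).
  by apply: contraNF eH => ei; rewrite !inE ei.
have c'j : cls c' j = (cls c i :|: cls c j) :\: A.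
  apply/setP=> e; rewrite in_setD inE ffunE; case: (boolP (e \in _ :|: _)) => eH.
    by case: ifP; rewrite ?eqxx // (negbTE ij).
  by rewrite andbF; apply: contraNF eH => ej; rewrite !inE ej orbT.
have c'l l : l != i -> l != j -> cls c' l = cls c l.
  move=> li lj; apply/setP=> e; rewrite inE ffunE; case: ifP => eH; last by rewrite inE.
  move: eH; rewrite !inE => /orP[] /eqP ->.
    by case: ifP; rewrite ![_ == l]eq_sym ?(negbTE li) ?(negbTE lj).
  by case: ifP; rewrite ![_ == l]eq_sym ?(negbTE li) ?(negbTE lj).
have sumij w : edeg en (cls c' i) w + edeg en (cls c' j) w
    = edeg en (cls c i) w + edeg en (cls c j) w.
  rewrite c'i c'j -[RHS]edeg_disjointU //.
  by rewrite /edeg [RHS](big_setID A) /= (setIidPr AH).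
have sq w := @sqr_balance (edeg en (cls c i) w) (edeg en (cls c j) w)
  (edeg en (cls c' i) w) (edeg en (cls c' j) w) (sumij w).
have Pc' : P c'.
  apply/PP => l w; have [->|li] := eqVneq l i; first by rewrite c'i oA Pc.
  have [->|lj] := eqVneq l j; last by rewrite c'l.
  have := congr1 odd (sumij w); rewrite !oddD !Pc addbb c'i oA Pc.
  by case: (odd _); case: (f w).
have := c_min _ Pc'; rewrite leqNgt => /negP[].
have sq_le w : edeg en (cls c' i) w ^ 2 + edeg en (cls c' j) w ^ 2
            <= edeg en (cls c i) w ^ 2 + edeg en (cls c j) w ^ 2.
  by case: (sq w); rewrite ?(PP _ Pc') ?Pc // c'i c'j; case: (bA w).
rewrite /M (bigD1 i) // [X in _ < X](bigD1 i) //= (bigD1 j) 1?eq_sym //.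
rewrite [X in _ < _ + X](bigD1 j) 1?eq_sym //= !addnA -!big_split /=.
rewrite (eq_bigr (fun l => \sum_w edeg en (cls c l) w ^ 2)); last first.
  by move=> l /andP[li lj]; rewrite c'l.
rewrite ltn_add2r (bigD1 v) // [X in _ < X](bigD1 v) //=.
apply: (@leq_add _.+1); last by apply: leq_sum.
by case: (sq v); rewrite ?(PP _ Pc') ?Pc // ?c'i ?c'j; case: (bA v) => // ? ? _; apply.
Qed.

Lemma near_average n (d : 'I_n -> nat) D :
  (forall i j, d i <= d j + 2) -> \sum_i d i = D ->
  forall i, n * d i < D + n.*2 /\ D < n * d i + n.*2.
Proof.
move=> dd <- i; split.
  have -> : n * d i = \sum_(j < n) d i by rewrite sum_nat_const card_ord.
  have -> : n.*2 = \sum_(j < n) 2 by rewrite sum_nat_const card_ord muln2.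
  rewrite -big_split /= (bigD1 i) // [X in _ < X](bigD1 i) //=.
  by apply: (@leq_add _.+1); [lia | apply: leq_sum].
have -> : n * d i = \sum_(j < n) d i by rewrite sum_nat_const card_ord.
have -> : n.*2 = \sum_(j < n) 2 by rewrite sum_nat_const card_ord muln2.
rewrite -big_split /= (bigD1 i) // [X in _ < X](bigD1 i) //=.
by apply: (@leq_add _.+1); [lia | apply: leq_sum].
Qed.

Lemma edeg_classes c A v :
  edeg en A v = \sum_i edeg en (A :&: cls c i) v.
Proof.
rewrite /edeg (partition_big c xpredT) //=; apply: eq_bigr => i _.
by apply: eq_bigl => e; rewrite !inE.
Qed.

Lemma sum_edeg_classes c v : \sum_i edeg en (cls c i) v = edeg en setT v.
Proof.
rewrite (edeg_classes c); apply: eq_bigr => i _.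
by rewrite setTI.
Qed.

Lemma parity_colouring_but_one c i0 :
  ~~ odd k -> (forall v, ~~ odd (edeg en setT v)) ->
  (forall i v, i != i0 -> odd (edeg en (cls c i) v) = f v) ->
  parity_colouring c.
Proof.
move=> evk evG Pc i v; have [->|] := eqVneq i i0; last exact: Pc.
have := evG v; rewrite -(sum_edeg_classes c) (bigD1 i0) //= oddD.
have -> : odd (\sum_(j | j != i0) edeg en (cls c j) v)
    = odd (\sum_(j < k | j != i0) f v).
  by rewrite 2!(@oddsum _ (fun j => j != i0)); apply: eq_bigr => j /Pc ->; rewrite oddb.
rewrite sum_nat_const oddM oddb.
have -> : odd #|[pred j : 'I_k | j != i0]|.
  have := cardC1 i0; rewrite card_ord => ->.
  by case: (k) (i0) evk => [[]//|n] _; rewrite /= negbK.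
by case: (odd _); case: (f v).
Qed.

End Balanced.
End Colourings.

Section Forests.

Set Implicit Arguments.
Unset Strict Implicit.
Unset Printing Implicit Defensive.

Variables (V E : finType) (en : E -> V * V).
Implicit Types (A B S : {set E}) (x y : V) (e p : E).

Local Notation conn := (conn en).

Lemma conn_setU1 e B x y :
  conn (e |: B) x y ->
  [\/ conn B x y, conn B x (en e).1 /\ conn B (en e).2 y
    | conn B x (en e).2 /\ conn B (en e).1 y].
Proof.
case/connectP=> s; elim: s x => [|z s IH] x /=; first by move=> _ ->; apply/Or31/conn_refl.
case/andP=> /exists_inP[e' e'B xz] zs ey.
have [e'e|ne'e] := eqVneq e' e; last first.
  have Bxz : conn B x z.
    apply/connect1/exists_inP; exists e' => //.
    by move: e'B; rewrite in_setU1 (negbTE ne'e).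
  by case: (IH z zs ey) => [Bzy|[Bz Bzy]|[Bz Bzy]]; [apply: Or31|apply: Or32|apply: Or33];
    rewrite ?(conn_trans Bxz).
subst e'; case/orP: xz => /eqP ee; have := IH z zs ey; rewrite ee /=.
  by case=> [Bzy|[_ Bzy]|[_ Bzy]]; [apply: Or32|apply: Or32|apply: Or31]; rewrite ?conn_refl.
by case=> [Bzy|[_ Bzy]|[_ Bzy]]; [apply: Or33|apply: Or31|apply: Or33]; rewrite ?conn_refl.
Qed.

Definition forest A := [forall p in A, ~~ conn (A :\ p) (en p).1 (en p).2].

Lemma forestP A :
  reflect {in A, forall p, ~~ conn (A :\ p) (en p).1 (en p).2} (forest A).
Proof. exact: forall_inP. Qed.

Lemma forest_sub A B : A \subset B -> forest B -> forest A.
Proof.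
move=> AB /forestP fB; apply/forestP=> p pA.
apply: contra (fB p (subsetP AB p pA)); apply: conn_mono; exact: setSD.
Qed.

Lemma forest_add A e :
  forest A -> ~~ conn A (en e).1 (en e).2 -> forest (e |: A).
Proof.
move=> /forestP fA nA; apply/forestP=> p; rewrite in_setU1.
have [->{p} _|pe /= pA] := eqVneq p e.
  by apply: contra nA; apply: conn_mono; apply/subsetP=> q; rewrite !inE; case: eqP.
have sub : A :\ p \subset A by exact: subsetDl.
have -> : (e |: A) :\ p = e |: (A :\ p).
  by apply/setP=> q; rewrite !inE; have [->|] := eqVneq q e; rewrite // eq_sym pe.
apply/negP=> /conn_setU1[|[c1 c2]|[c1 c2]]; first exact/negP/fA.
  case/negP: nA; apply: conn_trans (conn_mono sub _) (conn_trans (conn_edge en pA) _).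
    by rewrite conn_sym; exact: c1.
  by rewrite conn_sym; exact: conn_mono c2.
case/negP: nA; rewrite conn_sym.
apply: conn_trans (conn_mono sub _) (conn_trans (conn_edge en pA) _).
  by rewrite conn_sym; exact: c1.
by rewrite conn_sym; exact: conn_mono c2.
Qed.

Lemma forest_path A S x y :
  forest A -> conn A x y ->
  {in A, forall p, ~~ conn (A :\ p) x y -> p \in S} -> conn (A :&: S) x y.
Proof.
move=> /forestP fA Axy inS.
have [B /minsetP[Bxy Bmin] BA] := minset_exists (P := fun B => conn B x y) Axy.
suff BS : B \subset S by apply: conn_mono Bxy; rewrite subsetI BA.
apply/subsetP=> p pB; have pA := subsetP BA p pB; apply: inS => //.
have BpA : B :\ p \subset A :\ p by exact: setSD.
apply/negP=> Apxy; have /negP[] := fA p pA.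
move: Bxy; rewrite -(setD1K pB) => /conn_setU1[Bp|[c1 c2]|[c1 c2]].
- have := Bmin _ Bp (subsetDl _ _) => eB; move: pB.
  by rewrite -eB !inE eqxx.
- move/(conn_mono BpA): c1; rewrite conn_sym => c1; apply: conn_trans c1 _.
  by apply: conn_trans Apxy _; rewrite conn_sym; exact: conn_mono c2.
- move/(conn_mono BpA): c1; move/(conn_mono BpA): c2 => c2 c1.
  by apply: conn_trans c2 _; rewrite conn_sym in Apxy; apply: conn_trans Apxy _.
Qed.

Lemma forest_representatives A (W : {set V}) :
  forest A -> {in A, forall e, ((en e).1 \in W) && ((en e).2 \in W)} ->
  exists R : {set V},
    [/\ #|R| + #|A| = #|W|, {in W, forall x, exists2 r, r \in R & conn A x r}
      & {in R &, forall r r', conn A r r' -> r = r'}].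
Proof.
have [n] := ubnP #|A|; elim: n A => // n IH A; rewrite ltnS => leAn fA AW.
have [->|[p pA]] := set_0Vmem A.
  exists W; split=> [|x xW|r r' _ _]; first by rewrite cards0 addn0.
    by exists x => //; exact: conn_refl.
  by case/connectP=> -[|z s] //= /andP[/exists_inP[e]]; rewrite inE.
have sub : A :\ p \subset A by exact: subsetDl.
have cA := cardsD1 p A; rewrite pA add1n in cA.
have [||e eA|R [cR exR inR]] := IH (A :\ p); first by rewrite -ltnS -cA.
- exact: forest_sub fA.
- by apply: AW; apply: (subsetP sub).
have /andP[p1 p2] := AW p pA.
have [r1 r1R c1] := exR _ p1; have [r2 r2R c2] := exR _ p2.
have np := forestP A fA p pA.
have r12 : r1 != r2.
  by apply: contra np => /eqP e12; apply: conn_trans c1 _; rewrite e12 conn_sym.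
exists (R :\ r2); split=> [|x xW|r r' /setD1P[rr2 rR] /setD1P[r'r2 r'R]].
- by rewrite cA addnS -addSn -cR (cardsD1 r2 R) r2R.
- have [r rR cr] := exR x xW; have [er|nr] := eqVneq r r2; last first.
    by exists r; rewrite ?inE ?nr //; exact: conn_mono cr.
  exists r1; rewrite ?inE ?r12 // -?er.
  rewrite er in cr; apply: conn_trans (conn_mono sub cr) _.
  rewrite conn_sym in c2; apply: conn_trans (conn_mono sub c2) _.
  apply: conn_trans (conn_mono sub c1); rewrite conn_sym; exact: conn_edge.
- rewrite -(setD1K pA) => /conn_setU1[|[d1 d2]|[d1 d2]]; first exact: inR.
    have : conn (A :\ p) r' r2 by rewrite conn_sym in d2; exact: conn_trans c2.
    by move/(inR _ _ r'R r2R)=> e; rewrite e eqxx in r'r2.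
  have : conn (A :\ p) r r2 by exact: conn_trans c2.
  by move/(inR _ _ rR r2R)=> e; rewrite e eqxx in rr2.
Qed.

Lemma card_forest A (W : {set V}) :
  forest A -> {in A, forall e, ((en e).1 \in W) && ((en e).2 \in W)} ->
  W != set0 -> #|A| < #|W|.
Proof.
move=> fA AW /set0Pn[x xW]; have [R [<- exR _]] := forest_representatives fA AW.
have [r rR _] := exR x xW.
by rewrite -[X in X < _]add0n ltn_add2r; apply/card_gt0P; exists r.
Qed.

Section Packing.

Variable k : nat.
Implicit Types (q : {ffun E -> option 'I_k}) (i : 'I_k).

Definition part q i := [set e | q e == Some i].

Definition packing q := [forall i, forest (part q i)].

Definition exchange q e p i : {ffun E -> option 'I_k} :=
  [ffun e' => if e' == e then Some i else if e' == p then None else q e'].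

Definition exchanges q q' := [exists e, exists p, exists i,
  [&& q e == None, q p == Some i,
      ~~ conn (part q i :\ p) (en e).1 (en e).2 & q' == exchange q e p i]].

Definition uncovered q := [set e | q e == None].

(* E0 consists of the edges left uncovered by some packing reachable from q by
   exchanges; exchanges do not change the components of each forest within E0. *)
Lemma packing_closure q :
  packing q -> (forall q', packing q' -> #|uncovered q| <= #|uncovered q'|) ->
  exists E0 : {set E}, uncovered q \subset E0 /\
    forall i x y, conn E0 x y -> conn (part q i :&: E0) x y.
Proof.
move=> Pq q_max; pose reach := connect exchanges q.
pose E0 := [set e | [exists q', reach q' && (q' e == None)]].
have E0P q' e : reach q' -> q' e = None -> e \in E0.
  by move=> rq' q'e; rewrite inE; apply/existsP; exists q'; rewrite rq' q'e eqxx.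
pose good q' := [/\ packing q', #|uncovered q'| = #|uncovered q|
  & forall i x y, conn (part q' i :&: E0) x y = conn (part q i :&: E0) x y].
have part_exchange q' e p i : q' e = None -> q' p = Some i ->
    part (exchange q' e p i) i = e |: (part q' i :\ p).
  move=> q'e q'p; apply/setP=> e'; rewrite !inE ffunE.
  by have [_|_] := eqVneq e' e; [rewrite eqxx | have [_|] := eqVneq e' p].
have part_exchange' q' e p i j : q' e = None -> q' p = Some i -> j != i ->
    part (exchange q' e p i) j = part q' j.
  move=> q'e q'p ji; apply/setP=> e'; rewrite !inE ffunE.
  have [->|_] := eqVneq e' e; first by rewrite q'e; apply/eqP=> -[ij]; rewrite ij eqxx in ji.
  have [->|//] := eqVneq e' p; rewrite q'p.
  by apply/esym/eqP=> -[ij]; rewrite ij eqxx in ji.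
have span q' e i : reach q' -> good q' -> q' e = None ->
    conn (part q' i :&: E0) (en e).1 (en e).2.
  move=> rq' [/forallP Pq' cq' _] q'e; apply: forest_path => //; last first.
    move=> p; rewrite inE => /eqP q'p nc; apply: (E0P (exchange q' e p i)).
      apply: connect_trans rq' _; apply/connect1/existsP; exists e.
      by apply/existsP; exists p; apply/existsP; exists i; rewrite q'e q'p nc !eqxx.
    rewrite ffunE eqxx; case: eqP => // pe; by rewrite pe q'e in q'p.
  apply: contraT => nc.
  pose q2 : {ffun E -> option 'I_k} := [ffun e' => if e' == e then Some i else q' e'].
  have : packing q2.
    apply/forallP=> j; have [->|ji] := eqVneq j i.
      have -> : part q2 i = e |: part q' i.
        by apply/setP=> e'; rewrite !inE ffunE; have [_|_] := eqVneq e' e; rewrite ?eqxx.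
      exact: forest_add.
    have -> // : part q2 j = part q' j.
    apply/setP=> e'; rewrite !inE ffunE; have [->|//] := eqVneq e' e.
    by rewrite q'e; apply/eqP=> -[ij]; rewrite ij eqxx in ji.
  move/q_max; rewrite -cq' leqNgt => /negP[]; apply: proper_card.
  apply/properP; split; last by exists e; rewrite !inE ?ffunE ?q'e ?eqxx.
  by apply/subsetP=> e'; rewrite !inE ffunE; have [_|_] := eqVneq e' e.
have step q1 q2 : reach q1 -> good q1 -> exchanges q1 q2 -> good q2.
  move=> r1 g1 x12; have r2 : reach q2 := connect_trans r1 (connect1 x12).
  case/existsP: x12 => e /existsP[p /existsP[i]].
  case/and4P=> /eqP q1e /eqP q1p nc /eqP eq2; case: (g1) => /forallP P1 c1 s1.
  have ep : e != p by apply: contra_eq_neq q1p => <-; rewrite q1e.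
  have eE0 : e \in E0 by exact: E0P q1e.
  have pE0 : p \in E0 by apply: (E0P q2) => //; rewrite eq2 ffunE eq_sym (negbTE ep) eqxx.
  have pi : p \in part q1 i by rewrite inE q1p.
  have eqi : part q2 i = e |: (part q1 i :\ p) by rewrite eq2 part_exchange.
  have eqj j : j != i -> part q2 j = part q1 j by move=> ji; rewrite eq2 part_exchange'.
  split.
  - apply/forallP=> j; have [->|ji] := eqVneq j i; last by rewrite eqj.
    rewrite eqi forest_add //; apply: forest_sub (P1 i); exact: subsetDl.
  - rewrite -c1; have -> : uncovered q2 = p |: (uncovered q1 :\ e).
      apply/setP=> e'; rewrite !inE eq2 ffunE.
      have [->|e'e] := eqVneq e' e; first by rewrite (negbTE ep).
      by have [->|] := eqVneq e' p; rewrite ?eqxx.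
    rewrite cardsU1 !inE q1p andbF /=.
    by rewrite [RHS](cardsD1 e) inE q1e eqxx.
  move=> j x y; rewrite -s1; have [->{j}|ji] := eqVneq j i; last by rewrite eqj.
  have ce := span q1 e i r1 g1 q1e.
  apply/idP/idP; apply: conn_sub => e'; last first.
    rewrite in_setI => /andP[e'i e'E0]; have [->|e'p] := eqVneq e' p; last first.
      by apply: conn_edge; rewrite in_setI eqi in_setU1 in_setD1 e'p e'i e'E0 orbT.
    have pB : p \in part q1 i :&: E0 by rewrite in_setI pi pE0.
    move: ce; rewrite -(setD1K pB).
    set B := _ :\ p; have BS : B \subset part q2 i :&: E0.
      apply/subsetP=> e2; rewrite eqi in_setI in_setU1 !in_setD1 in_setI.
      by case/and3P=> -> -> ->; rewrite orbT.
    have ce2 : conn (part q2 i :&: E0) (en e).1 (en e).2.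
      by apply: conn_edge; rewrite in_setI eqi in_setU1 eqxx.
    case/conn_setU1=> [cB|[d1 d2]|[d1 d2]].
    - case/negP: nc; apply: conn_mono cB; apply: setSD; exact: subsetIl.
    - move/(conn_mono BS): d1; move/(conn_mono BS): d2 => d2 d1.
      rewrite conn_sym in d1; rewrite conn_sym in d2.
      exact: conn_trans d1 (conn_trans ce2 d2).
    - move/(conn_mono BS): d1; move/(conn_mono BS): d2 => d2 d1.
      by rewrite conn_sym in ce2; exact: conn_trans d2 (conn_trans ce2 d1).
  rewrite in_setI eqi in_setU1 in_setD1 => /andP[/orP[/eqP ->|/andP[_ e'i]] e'E0] //.
  by apply: conn_edge; rewrite in_setI e'i.
have good_reach q' : reach q' -> good q'.
  have g0 : good q by [].
  case/connectP=> s; elim/last_ind: s q' => [q' _ ->//|s q1 IH q'].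
  rewrite rcons_path last_rcons => /andP[ps x1] ->.
  apply: step x1 => //; last exact: IH.
  by apply/connectP; exists s.
exists E0; split.
  by apply/subsetP=> e; rewrite inE => /eqP; apply: E0P; exact: connect0.
move=> i x y; apply: conn_sub => e; rewrite inE => /existsP[q' /andP[rq' /eqP q'e]].
have g' := good_reach q' rq'; case: (g') => _ _ <-; exact: span.
Qed.

End Packing.
End Forests.

Section Lifting.

Set Implicit Arguments.
Unset Strict Implicit.
Unset Printing Implicit Defensive.

Variables (V E : finType) (k : nat).
Implicit Types (en : E -> V * V) (f : V -> bool) (X Y M U : {set V}) (e : E).

Definition nonloops en := [set e | (en e).1 != (en e).2].

Lemma ecutE en X :
  ecut en X = \sum_e (((en e).1 \in X) (+) ((en e).2 \in X)).
Proof. exact: card_sumb. Qed.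

Lemma ecutC en X : ecut en (~: X) = ecut en X.
Proof. by rewrite !ecutE; apply: eq_bigr => e _; rewrite !inE addNb addbN negbK. Qed.

Lemma odd_ecut en X :
  odd (ecut en X) = odd (\sum_(v in X) edeg en setT v).
Proof.
rewrite ecutE sum_edeg !oddsum; apply: eq_big => e; rewrite ?inE // => _.
by rewrite oddD !oddb.
Qed.

Lemma ecut_submod en X Y :
  ecut en (X :&: Y) + ecut en (X :|: Y) <= ecut en X + ecut en Y.
Proof.
rewrite !ecutE -!big_split /=; apply: leq_sum => e _; rewrite !inE.
by do 4!case: (_ \in _).
Qed.

Lemma ecut_posimod en X Y e :
  (en e).1 \in X :&: Y -> (en e).2 \notin X :|: Y ->
  ecut en (X :\: Y) + ecut en (Y :\: X) + 2 <= ecut en X + ecut en Y.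
Proof.
rewrite !inE negb_or => /andP[e1X e1Y] /andP[/negbTE e2X /negbTE e2Y].
rewrite !ecutE -!big_split /= (bigD1 e) //= [X in _ <= X](bigD1 e) //=.
rewrite !inE e1X e1Y e2X e2Y /= addnC leq_add2l; apply: leq_sum => e' _.
by rewrite !inE; do 4!case: (_ \in _).
Qed.

Definition odd_on f X := odd (\sum_(v in X) f v).

Lemma odd_on_setID f X Y : odd_on f X = odd_on f (X :&: Y) (+) odd_on f (X :\: Y).
Proof. by rewrite /odd_on (big_setID Y) oddD. Qed.

Lemma odd_on_setC f X : ~~ odd_on f setT -> odd_on f (~: X) = odd_on f X.
Proof.
by rewrite (odd_on_setID f setT X) setTI setTD; do 2!case: (odd_on _ _).
Qed.

Lemma odd_on_setU1 f X x : x \notin X -> odd_on f (x |: X) = f x (+) odd_on f X.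
Proof. by move=> xX; rewrite /odd_on big_setU1 //= oddD oddb. Qed.

Definition odd_cuts en f := forall X, odd_on f X -> k.*2 <= ecut en X.

Definition eulerian en := forall v, ~~ odd (edeg en setT v).

Lemma eulerian_ecut en X : eulerian en -> ~~ odd (ecut en X).
Proof.
move=> evG; rewrite odd_ecut oddsum big1 // => v _; exact/negbTE/evG.
Qed.

Lemma odd_cuts_total en f : 0 < k -> odd_cuts en f -> ~~ odd_on f setT.
Proof.
move=> k_gt0 cutG; apply/negP=> /cutG.
rewrite ecutE big1 => [|e _]; last by rewrite !inE.
by rewrite leqn0 double_eq0 eqn0Ngt k_gt0.
Qed.

Definition star en x := [set e | ((en e).1 == x) (+) ((en e).2 == x)].

Definition far_end en x e := if (en e).1 == x then (en e).2 else (en e).1.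

Lemma star_cut en x : #|star en x| = ecut en [set x].
Proof. by apply: eq_card => e; rewrite !inE. Qed.

Lemma starP en x e : e \in star en x ->
  far_end en x e != x /\ (en e = (x, far_end en x e) \/ en e = (far_end en x e, x)).
Proof.
rewrite inE /far_end; case: (en e) => a b /=.
by have [->|nax] := eqVneq a x; have [->|nbx] := eqVneq b x => // _;
  split; rewrite ?nax //; [left|right].
Qed.

(* The tight sets that contain the far end of e1 but not x are closed under
   union, so it suffices to take an edge at x whose far end is not in the largest
   of them. *)
Lemma splitting_pair en f x e1 :
  0 < k -> eulerian en -> odd_cuts en f -> ~~ f x -> e1 \in star en x ->
  exists2 e2, (e2 \in star en x) && (e2 != e1) &
    forall X, odd_on f X -> x \notin X -> far_end en x e1 \in X -> far_end en x e2 \in X ->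
    k.*2 + 2 <= ecut en X.
Proof.
move=> k_gt0 evG cutG fx e1x; set u := far_end en x e1.
have [ux e1E] := starP e1x; rewrite -/u in ux e1E.
pose tight X := [&& odd_on f X, x \notin X, u \in X & ecut en X == k.*2].
have slack X : odd_on f X -> x \notin X -> u \in X -> ~~ tight X -> k.*2 + 2 <= ecut en X.
  move=> oX xX uX; rewrite /tight oX xX uX /= => nX.
  have := cutG X oX; have := eulerian_ecut X evG; rewrite leq_eqVlt eq_sym (negbTE nX) /=.
  lia.
have xcut : 0 < ecut en [set x] by rewrite -star_cut; apply/card_gt0P; exists e1.
have tightU X Y : tight X -> tight Y -> tight (X :|: Y).
  case/and4P=> oX xX uX /eqP cX /and4P[oY xY uY /eqP cY].
  have oU : odd_on f (X :|: Y) = odd_on f X (+) odd_on f (Y :\: X).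
    rewrite (odd_on_setID f (X :|: Y) X) setUK; congr (_ (+) odd_on f _).
    by rewrite setDUl setDv set0U.
  have oX' := odd_on_setID f X Y; have oY' := odd_on_setID f Y X.
  rewrite setIC in oY'.
  have [oI|nI] := boolP (odd_on f (X :&: Y)).
    have oUt : odd_on f (X :|: Y).
      by rewrite oU oX; move: oY'; rewrite oY oI; case: (odd_on f (Y :\: X)).
    apply/and4P; split; rewrite // ?inE ?uX // ?negb_or ?xX //.
    have := ecut_submod en X Y; have := cutG _ oI; have := cutG _ oUt.
    by rewrite cX cY; clear; lia.
  have oD1 : odd_on f (X :\: Y).
    by move: oX'; rewrite oX (negbTE nI); case: (odd_on _ _).
  have oD2 : odd_on f (Y :\: X).
    by move: oY'; rewrite oY (negbTE nI); case: (odd_on _ _).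
  have := cutG _ oD1; have := cutG _ oD2.
  suff : ecut en (X :\: Y) + ecut en (Y :\: X) + 2 <= ecut en X + ecut en Y.
    by rewrite cX cY; clear; lia.
  case: e1E => e1E; last by apply: (@ecut_posimod _ _ _ e1); rewrite e1E !inE ?uX ?uY ?negb_or ?xX.
  have := @ecut_posimod en (~: X) (~: Y) e1; rewrite !ecutC !setDE !setCK.
  by rewrite e1E !inE uX uY xX xY (setIC _ Y) (setIC _ X) addnAC [_ + ecut _ (Y :&: _)]addnC
    => /(_ isT isT); clear; lia.
have [[X0 tX0]|] := altP (@existsP _ tight); last first.
  move=> /existsPn no_tight.
  have : 0 < #|star en x :\ e1|.
    have := cardsD1 e1 (star en x); rewrite e1x star_cut => cs.
    by have := eulerian_ecut [set x] evG; move: xcut; rewrite cs; clear; case: #|_|.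
  case/card_gt0P=> e2 /setD1P[e21 e2x]; exists e2; first by rewrite e2x.
  by move=> X oX xX uX _; exact: slack.
case: (arg_maxnP (fun X : {set V} => #|X|) tX0) => M tM Mmax.
have subM X : tight X -> X \subset M.
  move=> tX; have := Mmax _ (tightU _ _ tM tX) => leM.
  have /eqP-> : M == M :|: X by rewrite eqEcard subsetUl.
  exact: subsetUr.
case/and4P: (tM) => oM xM uM /eqP cM.
have [e2 e2x e2M] : exists2 e2, e2 \in star en x & far_end en x e2 \notin M.
  apply/exists_inP; apply: contraT => /exists_inPn inM.
  have oMx : odd_on f (x |: M) by rewrite odd_on_setU1 // (negbTE fx).
  have := cutG _ oMx.
  suff : ecut en (x |: M) + ecut en [set x] <= ecut en M.
    by rewrite cM; move: xcut; clear; lia.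
  rewrite !ecutE -big_split; apply: leq_sum => e _ /=.
  have [ex|] := boolP (e \in star en x).
    have /negPn oeM := inM e ex; have [ox [->|->]] := starP ex.
      by rewrite !inE eqxx oeM (negbTE ox) (negbTE xM).
    by rewrite !inE eqxx oeM (negbTE ox) (negbTE xM).
  rewrite !inE; case: eqP => [->|_]; case: eqP => [->|_] //= _.
  by rewrite addn0.
exists e2; first by rewrite e2x; apply: contraNneq e2M => ->.
move=> X oX xX uX wX; apply: slack => //.
by apply: contra e2M => /subM/subsetP; apply.
Qed.

(* The type of edges is kept: e1 becomes the new edge and e2 a loop. *)
Definition split_off en x e1 e2 : E -> V * V := fun e =>
  if e == e1 then (far_end en x e1, far_end en x e2) else if e == e2 then (x, x) else en e.

Lemma split_off1 en x e1 e2 : split_off en x e1 e2 e1 = (far_end en x e1, far_end en x e2).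
Proof. by rewrite /split_off eqxx. Qed.

Lemma split_off2 en x e1 e2 : e2 != e1 -> split_off en x e1 e2 e2 = (x, x).
Proof. by rewrite /split_off eqxx => /negbTE->. Qed.

Lemma split_off3 en x e1 e2 e : e != e1 -> e != e2 -> split_off en x e1 e2 e = en e.
Proof. by rewrite /split_off => /negbTE-> /negbTE->. Qed.

Lemma edeg_split_off en x e1 e2 v :
  e1 \in star en x -> e2 \in star en x -> e2 != e1 ->
  edeg (split_off en x e1 e2) setT v = edeg en setT v.
Proof.
move=> e1x e2x e21; rewrite /edeg (bigD1 e1) // [RHS](bigD1 e1) //=.
rewrite (bigD1 e2) ?inE // [X in _ = _ + X](bigD1 e2) ?inE //= !addnA; congr (_ + _).
  rewrite split_off1 split_off2 //=.
  by have [_ [->|->]] := starP e1x; have [_ [->|->]] := starP e2x => /=; clear; lia.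
by apply: eq_bigr => e /andP[/andP[_ ee1] ee2]; rewrite split_off3.
Qed.

Lemma ecut_split_off en f x e1 e2 :
  e1 \in star en x -> e2 \in star en x -> e2 != e1 -> ~~ odd_on f setT ->
  odd_cuts en f ->
  (forall X, odd_on f X -> x \notin X -> far_end en x e1 \in X -> far_end en x e2 \in X ->
    k.*2 + 2 <= ecut en X) ->
  odd_cuts (split_off en x e1 e2) f.
Proof.
move=> e1x e2x e21 ft cutG slack X oX.
have : ecut en X <= ecut (split_off en x e1 e2) X
  + 2 * (((x \in X) (+) (far_end en x e1 \in X)) && ((x \in X) (+) (far_end en x e2 \in X))).
  rewrite !ecutE (bigD1 e1) // [X in _ <= X + _](bigD1 e1) //=.
  rewrite (bigD1 e2) // [X in _ <= _ + X + _](bigD1 e2) //=.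
  rewrite [X in _ <= _ + (_ + X) + _](eq_bigr
    (fun e => ((en e).1 \in X) (+) ((en e).2 \in X) : nat)); last first.
    by move=> e /andP[ee1 ee2]; rewrite split_off3.
  rewrite split_off1 split_off2 //=; have [_ [->|->]] := starP e1x; have [_ [->|->]] := starP e2x => /=;
  by case: (x \in X); case: (far_end _ _ e1 \in X); case: (far_end _ _ e2 \in X) => /=; clear; lia.
have := cutG X oX; case: (boolP (_ && _)) => [|_]; last by clear; lia.
have [xX|xX] := boolP (x \in X).
  case/andP=> /= uX wX; have := slack (~: X).
  by rewrite odd_on_setC // ecutC !inE xX uX wX => /(_ oX isT isT isT); clear; lia.
by case/andP=> /= uX wX; have := slack X oX xX uX wX; clear; lia.
Qed.

Lemma colour_split_off en f x e1 e2 (c : {ffun E -> 'I_k}) :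
  e1 \in star en x -> e2 \in star en x -> e2 != e1 ->
  parity_colouring (split_off en x e1 e2) f c ->
  parity_colouring en f [ffun e => if e == e2 then c e1 else c e].
Proof.
move=> e1x e2x e21 Pc i v; rewrite -(Pc i v) !odd_edeg.
rewrite (bigD1 e1) // [RHS](bigD1 e1) //= (bigD1 e2) // [X in _ = _ (+) X](bigD1 e2) //=.
rewrite !addbA; congr (_ (+) _).
  rewrite split_off1 split_off2 // !inE !ffunE eqxx [e1 == e2]eq_sym (negbTE e21) /=.
  have [_ [->|->]] := starP e1x; have [_ [->|->]] := starP e2x => /=;
  by case: (c e1 == i); case: (c e2 == i); case: (x == v);
    case: (far_end _ _ e1 == v); case: (far_end _ _ e2 == v).
apply: eq_bigr => e /andP[/negbTE ee1 /negbTE ee2].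
by rewrite /split_off !inE ffunE ee1 ee2.
Qed.

Lemma nonloops_split_off en x e1 e2 :
  e1 \in star en x -> e2 \in star en x -> e2 != e1 ->
  #|nonloops (split_off en x e1 e2)| < #|nonloops en|.
Proof.
have star_nonloop e : e \in star en x -> e \in nonloops en.
  by case/starP=> ox [ee|ee]; rewrite inE ee //= eq_sym.
move=> e1x e2x e21; apply: proper_card; apply/properP; split.
  apply/subsetP=> e; rewrite inE /split_off; have [->|_] := eqVneq e e1.
    by rewrite star_nonloop.
  by have [->|_] := eqVneq e e2; rewrite ?eqxx // inE.
by exists e2; [exact: star_nonloop | rewrite inE /split_off (negbTE e21) eqxx /= eqxx].
Qed.

End Lifting.

Section Existence.

Set Implicit Arguments.
Unset Strict Implicit.
Unset Printing Implicit Defensive.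

Variables (V E : finType) (k : nat).
Implicit Types (en : E -> V * V) (f : V -> bool) (X U : {set V}) (e : E).

Hypothesis evk : ~~ odd k.

Lemma sum_join_exists en (A U : {set _}) (g : V -> bool) :
  {in U &, forall x y, conn en A x y} ->
  {in A, forall e, ((en e).1 \in U) = ((en e).2 \in U)} ->
  ~~ odd (\sum_(v in U) g v) ->
  exists2 J : {set E}, J \subset A &
    forall v, odd (edeg en J v) = (v \in U) && g v.
Proof.
move=> cU clU evU; apply: join_exists => x.
have [xU|xU] := boolP (x \in U).
  rewrite (eq_bigl (fun v => v \in U)) => [|v].
    rewrite (eq_bigr (fun v => g v : nat)) // => v ->; exact: erefl.
  by apply/idP/idP => [/(conn_closed clU) <-|vU] //; exact: cU.
rewrite big1 // => v /(conn_closed clU); rewrite (negbTE xU) => /esym.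
by move=> /negbT/negbTE->.
Qed.

Lemma disjoint_spanning_colouring en f (i0 : 'I_k) (T : 'I_k -> {set E}) :
  eulerian en -> ~~ odd_on f setT ->
  (forall i x y, conn en (T i) x y) ->
  (forall i j, i != j -> [disjoint T i & T j]) ->
  exists c : {ffun E -> 'I_k}, parity_colouring en f c.
Proof.
move=> evG ft cT dT.
have [|J JT oJ] := @fin_all_exists2 _ _ (fun i (J : {set E}) => J \subset T i)
    (fun i J => forall v, odd (edeg en J v) = f v).
  move=> i; have [|||J JT oJ] := @sum_join_exists en (T i) setT f.
  - by move=> x y _ _; exact: cT.
  - by move=> e _; rewrite !inE.
  - exact: ft.
  - by exists J => // v; rewrite oJ inE.
pose c : {ffun E -> 'I_k} := [ffun e => odflt i0 [pick i | e \in J i]].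
exists c; apply: (@parity_colouring_but_one _ _ en k f c i0) => // i v ii0.
rewrite -(oJ i v); congr (odd (edeg _ _ _)); apply/setP=> e; rewrite inE ffunE.
case: pickP => [j ej|no_j] /=; last by rewrite no_j eq_sym (negbTE ii0).
apply/idP/idP => [/eqP<- //|ei]; apply: contraT => /dT/disjoint_setI0 dij.
by have := in_set0 e; rewrite -dij inE (subsetP (JT j) e ej) (subsetP (JT i) e ei).
Qed.

(* The type of vertices is kept: U is contracted to u and the other vertices of U
   become isolated, while the edges inside U become loops. *)
Definition contract U u en : E -> V * V := fun e =>
  let r v := if v \in U then u else v in (r (en e).1, r (en e).2).

Definition pushforward U u f y := odd (\sum_(v | (if v \in U then u else v) == y) f v).

Section Contraction.

Variables (en : E -> V * V) (f : V -> bool) (U : {set V}) (u : V).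
Hypothesis uU : u \in U.
Let r v := if v \in U then u else v.

Lemma edeg_contract A y :
  edeg (contract U u en) A y = \sum_(v | r v == y) edeg en A v.
Proof.
rewrite exchange_big; apply: eq_bigr => e _ /=; rewrite big_split /=.
have sumr w : \sum_(v | r v == y) (w == v) = (r w == y).
  have := sum_eqb [set v | r v == y] w; rewrite inE => <-.
  by apply: eq_bigl => v; rewrite inE.
by rewrite !sumr.
Qed.

Lemma odd_on_contract X :
  odd_on (pushforward U u f) X = odd_on f [set v | r v \in X].
Proof.
rewrite /odd_on [in RHS](partition_big r (fun y => y \in X)) /=; last by move=> v; rewrite inE.
rewrite !oddsum; apply: eq_bigr => y yX; rewrite oddb /pushforward; congr odd.
apply: eq_bigl => v; rewrite inE -/(r v).
by have [->|_] := eqVneq (r v) y; rewrite ?yX ?andbF.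
Qed.

Lemma eulerian_contract : eulerian en -> eulerian (contract U u en).
Proof.
move=> evG v; rewrite edeg_contract oddsum big1 // => w _; exact/negbTE/evG.
Qed.

Lemma odd_cuts_contract : odd_cuts k en f -> odd_cuts k (contract U u en) (pushforward U u f).
Proof.
move=> cutG X; rewrite odd_on_contract => /cutG.
by congr (_ <= _); rewrite !ecutE; apply: eq_bigr => e _; rewrite !inE.
Qed.

Lemma nonloops_contract e :
  e \in nonloops en -> (en e).1 \in U -> (en e).2 \in U ->
  #|nonloops (contract U u en)| < #|nonloops en|.
Proof.
move=> e_nl e1 e2; apply: proper_card; apply/properP; split.
  apply/subsetP=> e'; rewrite !inE; apply: contra => /eqP /= ee; by rewrite ee.
by exists e; rewrite // inE /= e1 e2 eqxx.
Qed.

(* The edges inside U are recoloured: each class takes a join in its own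
   connected spanning subgraph of U, and class i0 takes what is left. *)
Lemma colour_contract (T : 'I_k -> {set E}) (i0 : 'I_k) (c : {ffun E -> 'I_k}) :
  eulerian en ->
  (forall i, {in U &, forall x y, conn en (T i) x y}) ->
  (forall i, {in T i, forall e, ((en e).1 \in U) = ((en e).2 \in U)}) ->
  (forall i j, i != j -> [disjoint T i & T j]) ->
  parity_colouring (contract U u en) (pushforward U u f) c ->
  exists c' : {ffun E -> 'I_k}, parity_colouring en f c'.
Proof.
move=> evG cT clT dT Pc.
pose inside := [set e | ((en e).1 \in U) && ((en e).2 \in U)].
pose outer i := cls c i :\: inside.
pose g i v := f v (+) odd (edeg en (outer i) v).
have g_even i : ~~ odd (\sum_(v in U) g i v).
  have sumU (F : V -> nat) : \sum_(v | r v == u) F v = \sum_(v in U) F v.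
    apply: eq_bigl => v; rewrite /r; case: ifP => [_|vU]; first by rewrite eqxx.
    by apply: contraFF vU => /eqP->.
  have := Pc i u; rewrite edeg_contract /pushforward -/r !sumU.
  have -> : odd (\sum_(v in U) edeg en (cls c i) v) = odd (\sum_(v in U) edeg en (outer i) v).
    rewrite !sum_edeg (big_setID inside) /= oddD -[RHS]addFb; congr (_ (+) _).
    rewrite oddsum big1 // => e; rewrite !inE => /andP[_ /andP[-> ->]]; by [].
  move=> eq_odd; suff -> : odd (\sum_(v in U) g i v)
      = odd (\sum_(v in U) f v) (+) odd (\sum_(v in U) edeg en (outer i) v).
    by rewrite eq_odd addbb.
  rewrite 3!(@oddsum _ (fun v => v \in U)) -big_split /=.
  by apply: eq_bigr => v _; rewrite /g !oddb.
have [|J JT oJ] := @fin_all_exists2 _ _ (fun i (J : {set E}) => J \subset T i)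
    (fun i J => forall v, odd (edeg en J v) = (v \in U) && g i v).
  move=> i; exact: sum_join_exists.
pose c' : {ffun E -> 'I_k} :=
  [ffun e => if e \in inside then odflt i0 [pick i | e \in J i] else c e].
exists c'; apply: (@parity_colouring_but_one _ _ en k f c' i0) => // i v ii0.
have c'i : cls c' i = (J i :&: inside) :|: outer i.
  apply/setP=> e; rewrite in_set in_setU in_setD in_setI ffunE in_set.
  case: ifP => e_in; rewrite ?andbT ?andbF ?orbF //=; last by rewrite inE.
  case: pickP => [j ej|no_j] /=; last by rewrite no_j eq_sym (negbTE ii0).
  apply/idP/idP => [/eqP<- //|ei]; apply: contraT => /dT/disjoint_setI0 dij.
  by have := in_set0 e; rewrite -dij inE (subsetP (JT j) e ej) (subsetP (JT i) e ei).
have oJi : odd (edeg en (J i :&: inside) v) = (v \in U) && g i v.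
  have [vU|vU] := boolP (v \in U); last first.
    rewrite odd_edeg big1 // => e _; rewrite !inE.
    have [->|_] := eqVneq (en e).1 v; first by rewrite (negbTE vU) andbF.
    by have [->|_] := eqVneq (en e).2 v; rewrite ?(negbTE vU) !andbF.
  have := oJ i v; rewrite vU => <-; rewrite !odd_edeg; apply: eq_bigr => e _.
  rewrite !inE; have [eJ|//] := boolP (e \in J i).
  have clE := clT i e (subsetP (JT i) e eJ).
  have [e1v|_] := eqVneq (en e).1 v; have [e2v|_] := eqVneq (en e).2 v;
    rewrite ?andbF ?addbb ?andbF //=.
    by rewrite -clE e1v vU.
  by rewrite clE e2v vU.
rewrite c'i edeg_disjointU; last first.
  by rewrite disjoint_subset; apply/subsetP=> e; rewrite !inE => /andP[_ ->].
rewrite oddD oJi; have [vU|vU] := boolP (v \in U).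
  by rewrite /g -addbA addbb addbF.
have rv w : (r w == v) = (w == v).
  rewrite /r; case: ifP => // wU; apply/eqP/eqP => e; last by rewrite -e wU in vU.
  by rewrite -e uU in vU.
have := Pc i v; rewrite edeg_contract /pushforward -/r !(big_pred1 v) // oddb => <-.
rewrite /=; congr odd; rewrite [RHS](big_setID inside) /= big1 // => e.
rewrite !inE => /andP[_ /andP[e1 e2]].
have [e1v|_] := eqVneq (en e).1 v; first by rewrite e1v (negbTE vU) in e1.
by have [e2v|//] := eqVneq (en e).2 v; rewrite e2v (negbTE vU) in e2.
Qed.

End Contraction.

Lemma dense_clump en (W : {set V}) :
  0 < k -> W != set0 -> k * #|W| <= #|nonloops en| ->
  {in nonloops en, forall e, ((en e).1 \in W) && ((en e).2 \in W)} ->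
  exists e0 (U : {set V}) (T : 'I_k -> {set E}),
    [/\ e0 \in nonloops en, (en e0).1 \in U, (en e0).2 \in U,
        (forall i, {in U &, forall x y, conn en (T i) x y})
        /\ (forall i, {in T i, forall e, ((en e).1 \in U) = ((en e).2 \in U)})
      & forall i j, i != j -> [disjoint T i & T j]].
Proof.
move=> k_gt0 W0 dense nlW.
pose q0 : {ffun E -> option 'I_k} := [ffun=> None].
have Pq0 : packing en q0.
  by apply/forallP=> i; apply/forestP=> e; rewrite inE ffunE.
case: (@arg_minnP _ q0 (@packing _ _ en k) (fun q => #|uncovered q|) Pq0) => q Pq qmin.
have [E0 [uE0 span]] := packing_closure Pq qmin.
have part_nl i : part q i \subset nonloops en.
  apply/subsetP=> e eq; move: (forallP Pq i) => /forestP/(_ e eq).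
  by rewrite inE; apply: contra => /eqP->; exact: conn_refl.
have [e0 e0nl e0u] : exists2 e0, e0 \in nonloops en & e0 \in uncovered q.
  apply/exists_inP; apply: contraLR dense => /exists_inPn no_e; rewrite -ltnNge.
  have sub : nonloops en \subset \bigcup_i part q i.
    apply/subsetP=> e /no_e; rewrite inE; case qe: (q e) => [i|//] _.
    by apply/bigcupP; exists i; rewrite // inE qe.
  apply: leq_ltn_trans (subset_leq_card sub) _.
  have leU : #|\bigcup_i part q i| <= \sum_i #|part q i|.
    elim/big_ind2: _ => [|A m B n leA leB|//]; first by rewrite cards0.
    by apply: leq_trans (leq_add leA leB); rewrite cardsU leq_subr.
  apply: leq_ltn_trans leU _.
  apply: (@leq_ltn_trans (\sum_(i < k) #|W|.-1)).
    apply: leq_sum => i _; rewrite -ltnS prednK ?card_gt0 //.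
    apply: card_forest (forallP Pq i) _ W0 => e /(subsetP (part_nl i)); exact: nlW.
  rewrite sum_nat_const card_ord ltn_pmul2l // prednK ?card_gt0 //.
pose U := [set v | conn en E0 (en e0).1 v].
have clE0 := @comp_closed _ _ en E0 (en e0).1; rewrite -/U in clE0.
have e0E : e0 \in E0 := subsetP uE0 e0 e0u.
exists e0, U, (fun i => part q i :&: E0); split=> //.
- by rewrite inE conn_refl.
- by rewrite inE conn_edge.
- split=> i; last by move=> e /setIP[_]; exact: clE0.
  move=> x y; rewrite !inE => cx cy; apply: span; apply: conn_trans cy.
  by rewrite conn_sym.
move=> i j ij; apply/pred0P=> e /=; rewrite !inE.
by case: eqP => //= ->; apply/negbTE; rewrite negb_and; apply/orP; right;
  apply/negP => /andP[/eqP[eij]]; rewrite eij eqxx in ij.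
Qed.

Lemma odd_cuts_colouring en f :
  0 < k -> eulerian en -> odd_cuts k en f ->
  exists c : {ffun E -> 'I_k}, parity_colouring en f c.
Proof.
move=> k_gt0; have [n] := ubnP #|nonloops en|.
elim: n en f => // n IH en f; rewrite ltnS => le_n evG cutG.
have ft := odd_cuts_total k_gt0 cutG.
pose i0 := Ordinal k_gt0.
have [/exists_inP[x fx /existsP[e1 e1x]]|] :=
  boolP [exists (x | ~~ f x), exists e, e \in star en x].
  have [e2 /andP[e2x e21] slack] := splitting_pair k_gt0 evG cutG fx e1x.
  have [|||c Pc] := IH (split_off en x e1 e2) f.
  - exact: leq_trans (nonloops_split_off e1x e2x e21) le_n.
  - by move=> v; rewrite edeg_split_off.
  - exact: ecut_split_off.
  exact: ex_intro (colour_split_off e1x e2x e21 Pc).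
move=> /exists_inPn no_star.
pose W := [set v | f v].
have starW e v : e \in star en v -> v \in W.
  by move=> ev; rewrite inE; apply: contraT => /no_star/existsPn/(_ e); rewrite ev.
have nlW : {in nonloops en, forall e, ((en e).1 \in W) && ((en e).2 \in W)}.
  move=> e; rewrite inE => ne; apply/andP; split; apply: (starW e).
    by rewrite inE eqxx eq_sym (negbTE ne).
  by rewrite inE eqxx (negbTE ne).
have cutW v : v \in W -> k.*2 <= ecut en [set v].
  by rewrite inE => fv; apply: cutG; rewrite /odd_on big_set1 oddb.
have [W0|Wn0] := eqVneq W set0.
  exists [ffun=> i0] => i v; have fv : f v = false.
    by apply/negbTE; have := in_set0 v; rewrite -W0 inE => ->.
  rewrite fv odd_edeg big1 // => e _; have [en0|] := eqVneq (en e).1 (en e).2.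
    by rewrite en0 addbb andbF.
  by move=> ne; have := nlW e; rewrite W0 !inE ne => /(_ isT).
have dense : k * #|W| <= #|nonloops en|.
  have double_le : (k * #|W|).*2 <= \sum_(v in W) ecut en [set v].
    rewrite doubleMl mulnC -sum_nat_const; exact: leq_sum cutW.
  rewrite -leq_double; apply: leq_trans double_le _.
  under eq_bigr do rewrite ecutE.
  rewrite exchange_big /= card_sumb -mul2n big_distrr /=.
  apply: leq_sum => e _; have [ee|ne] := eqVneq (en e).1 (en e).2.
    by rewrite ee big1 // => v _; rewrite addbb.
  apply: (@leq_trans (\sum_(v in W) (((en e).1 == v) + ((en e).2 == v)))).
    by apply: leq_sum => v _; rewrite !inE; do 2!case: eqP.
  by rewrite big_split /= !sum_eqb; do 2!case: (_ \in _).
have [e0 [U [T [e0nl e0U e0U' [cT clT] dT]]]] := dense_clump k_gt0 Wn0 dense nlW.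
have [|||c Pc] := IH (contract U (en e0).1 en) (pushforward U (en e0).1 f).
- exact: leq_trans (nonloops_contract _ e0nl e0U e0U') le_n.
- exact: eulerian_contract.
- exact: odd_cuts_contract.
exact: (colour_contract e0U i0 evG cT clT dT Pc).
Qed.

End Existence.

Local Open Scope ring_scope.

Lemma natr_Z2 (n : nat) (a : 'Z_2) : (n%:R == a) = (odd n == (a == 1)).
Proof.
have -> : n%:R = (odd n)%:R :> 'Z_2.
  rewrite -{1}(odd_double_half n) natrD -muln2 natrM.
  have -> : 2%:R = 0 :> 'Z_2 by exact: val_inj.
  by rewrite mulr0 addr0.
by case: (odd n); case: a => -[|[|//]].
Qed.

Theorem theorem4p4 (k : nat) (k_gt0 : (0 < k)%N) (k_even : ~~ odd k)
    (G : mgraph) (G_even : forall v : vertex G, ~~ odd (deg [set: edge G] v))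
    (f : vertex G -> 'Z_2) (f_sum : \sum_(v : vertex G) f v = 0)
    (hG : (forall X : {set vertex G},
              \sum_(v in X) f v = 1 -> (3 * k - 2 <= cut_deg X)%N)
          \/ tree_connected (2 * k - 2) G) :
  exists F : 'I_k -> {set edge G},
    [/\ edge_decomposition F,
        forall i, parity_factor f (F i)
      & forall i v,
          `|(deg (F i) v)%:R - (deg [set: edge G] v)%:R / k%:R| < 2 :> rat].
Proof.
pose en := @ends G; pose g v := f v == 1.
have sum_f (X : {set vertex G}) : \sum_(v in X) f v = (\sum_(v in X) g v)%N%:R.
  rewrite natr_sum; apply: eq_bigr => v _; apply/esym/eqP.
  by rewrite natr_Z2 /g oddb.
have odd_g X : odd_on g X = (\sum_(v in X) f v == 1).
  by rewrite sum_f natr_Z2 eqxx eqb_id.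
have k_ge2 : (1 < k)%N by case: (k) k_gt0 k_even => [|[|]].
have [c0 P0] : exists c : {ffun edge G -> 'I_k}, parity_colouring en g c.
  case: hG => [cutG|[T [treeT dT]]].
    apply: odd_cuts_colouring => // X; rewrite odd_g => /eqP/cutG.
    by apply: leq_trans; lia.
  have le_k : (k <= 2 * k - 2)%N by lia.
  apply: (@disjoint_spanning_colouring _ _ _ k_even en g (Ordinal k_gt0)
    (fun i => T (widen_ord le_k i))) => //.
  - by rewrite odd_g (eq_bigl xpredT) ?f_sum // => v; rewrite inE.
  - by move=> i x y; case: (treeT (widen_ord le_k i)) => + _; apply.
  - by move=> i j ij; apply: dT; rewrite -val_eqE.
have [c Pc bal] := balanced_colouring P0.
exists (cls c); split.
- split=> [|i j ij].
    by apply/setP=> e; rewrite inE; apply/bigcupP; exists (c e); rewrite // inE.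
  apply/pred0P=> e /=; rewrite !inE.
  by case: eqP => // ->; rewrite (negbTE ij).
- by move=> i v; apply/eqP; rewrite natr_Z2; apply/eqP; exact: Pc.
move=> i v; have := near_average (fun i j => bal i j v) (sum_edeg_classes en c v) i.
rewrite -[deg (cls c i) v]/(edeg en (cls c i) v) -[deg setT v]/(edeg en setT v).
move: (edeg _ _ _) (edeg _ _ _) => D d [lt1 lt2].
have k_gt0' : 0 < k%:R :> rat by rewrite ltr0n.
have Dk : D%:R / k%:R * k%:R = D%:R :> rat by rewrite divfK ?gt_eqF.
move: lt1 lt2; rewrite -!(ltr_nat rat).
rewrite -!mul2n !natrD !natrM => lt1 lt2; rewrite ltr_norml.
by apply/andP; split; rewrite -(ltr_pM2r k_gt0') mulrBl Dk; lra.
Qed.
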